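(* Let $n,m_1,\dots,m_n$ be positive integers with $1\le m_i\le n$ for all $i$, and let $m=\sum_i m_i$. Let $(\mathcal{P},\subseteq)$ be a poset on subsets of $\{1,\dots,m\}$ formed by $n$ disjoint paths of lengths $m_1,\dots,m_n$; that is, $\mathcal{P}=A_1\sqcup\cdots\sqcup A_n$ with $A_i=\{\{a_{i,1}\},\{a_{i,1},a_{i,2}\},\dots,\{a_{i,1},\dots,a_{i,m_i}\}\}$, where the $a_{i,j}$ ($1\le i\le n$, $1\le j\le m_i$) are the $m$ distinct elements of $\{1,\dots,m\}$. If $n>2$, or if $n=2$ and $m_1=m_2$, then there is a squarefree monomial ideal $I\subseteq\mathbf{k}[x_1,\dots,x_m]$ ($\mathbf{k}$ a field) whose support poset is $(\mathcal{P},\subseteq)$. Moreover, if $m_i>1$ for all $i$, then there is a zero-dimensional monomial ideal copolar to $I$.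
   Context: For a monomial ideal $I$, $G(I)$ is its unique minimal set of monomial generators. The support $\operatorname{supp}(m)$ of a monomial $m$ is the set of indices of the variables dividing $m$. Ideals are assumed to have full support, i.e. every variable of the ambient ring divides some minimal generator. Support poset: for a squarefree monomial ideal $I\subseteq\mathbf{k}[x_1,\dots,x_m]$ and each index $i$, let $C_i=\bigcap\{\operatorname{supp}(\mu): \mu\in G(I),\ x_i\text{ divides }\mu\}$. The support poset of $I$ is the set $\{C_1,\dots,C_m\}$ ordered by inclusion. Polarization: for a monomial ideal $J\subseteq\mathbf{k}[y_1,\dots,y_k]$, let $a_i$ be the maximum exponent with which $y_i$ appears among the elements of $G(J)$. The polarization of $y_1^{b_1}\cdots y_k^{b_k}$ (with $b_i\le a_i$) is $\prod_i y_{i,1}\cdots y_{i,b_i}$ in $\mathbf{k}[y_{1,1},\dots,y_{1,a_1},\dots,y_{k,1},\dots,y_{k,a_k}]$, and $J^P$ is the ideal generated by the polarizations of the elements of $G(J)$. Two monomial ideals $I$ and $J$ are copolar if their polarizations are equivalent, i.e. there is a bijection between the variables of the rings containing $I^P$ and $J^P$ carrying $G(I^P)$ onto $G(J^P)$. A monomial ideal is zero-dimensional if the quotient of its ambient ring by it has Krull dimension $0$. *)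

(* Defs.v *)
From Stdlib Require ClassicalEpsilon.
From HB Require Import structures.
From mathcomp Require Import all_boot all_order all_algebra.
From mathcomp Require Import finmap mpoly.

Set Implicit Arguments.
Unset Strict Implicit.
Unset Printing Implicit Defensive.

Import GRing.Theory.
Local Open Scope ring_scope.

(* Chains P_0 < ... < P_d of prime ideals.  [idealr_closed] includes properness.
   In the classical setting used here every subset of [A] is a boolean
   predicate, so quantifying over {pred A} quantifies over all subsets. *)
Definition prime_chain (A : comNzRingType) (d : nat) (P : nat -> {pred A}) :
    Prop :=
  (forall i, (i <= d)%N -> idealr_closed (P i) /\ prime_idealr_closed (P i)) /\
  (forall i, (i < d)%N ->
     {subset P i <= P i.+1} /\ exists2 x, x \in P i.+1 & x \notin P i).

Definition krull_dim (A : comNzRingType) (d : nat) : Prop :=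
  (exists P : nat -> {pred A}, prime_chain d P) /\ ~ (exists P : nat -> {pred A}, prime_chain d.+1 P).

Section MonomialIdeals.

Variables (K : fieldType) (n : nat).

Implicit Types (I : {mpoly K[n]} -> Prop) (mu : 'X_{1..n}).

Definition generated_by (S : 'X_{1..n} -> Prop) (p : {mpoly K[n]}) : Prop :=
  exists2 s : seq ({mpoly K[n]} * 'X_{1..n}),
    (forall u, u \in s -> S u.2) & p = \sum_(u <- s) u.1 * 'X_[u.2].

Definition monomial_ideal I : Prop :=
  exists S : 'X_{1..n} -> Prop, forall p, I p <-> generated_by S p.

Definition squarefree mu : Prop := forall i, (mu i <= 1)%N.

Definition squarefree_monomial_ideal I : Prop :=
  exists2 S : 'X_{1..n} -> Prop,
    (forall mu, S mu -> squarefree mu) & forall p, I p <-> generated_by S p.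

Definition generates (G : {fset 'X_{1..n}}) I : Prop :=
  forall p, I p <-> generated_by (fun mu => mu \in G) p.

Definition minimal_generators (G : {fset 'X_{1..n}}) I : Prop :=
  generates G I /\
  forall H : {fset 'X_{1..n}}, (H `<=` G)%fset -> generates H I -> H = G.

(* G(I).  Every monomial ideal has exactly one minimal set of monomial
   generators and it is finite (Dickson); if [I] is not a monomial ideal the
   value is unspecified. *)
Definition mingens I : {fset 'X_{1..n}} :=
  ClassicalEpsilon.epsilon (inhabits fset0) (fun G => minimal_generators G I).

Definition full_support I : Prop :=
  forall i : 'I_n, exists2 mu, mu \in mingens I & (0 < mu i)%N.

Definition msupport mu : {set 'I_n} := [set i | (0 < mu i)%N].

Definition support_class I (i : 'I_n) : {set 'I_n} :=
  \bigcap_(mu <- mingens I | (0 < mu i)%N) msupport mu.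

(* The underlying set of the support poset; its order is inclusion. *)
Definition support_poset I : {set {set 'I_n}} :=
  [set support_class I i | i : 'I_n].

(* The exponent a_i of the definition of polarization. *)
Definition max_exponent I (i : 'I_n) : nat := \max_(mu <- mingens I) mu i.

Definition zero_dimensional I : Prop :=
  exists2 A : idealr {mpoly K[n]},
    (forall p, I p <-> p \in A) & krull_dim {ideal_quot A} 0.

End MonomialIdeals.

(* The variables y_{i,j} (1 <= j <= a_i) are numbered by the bijection
   tagnat.sig between 'I_(\sum_i a_i) and the pairs (i, j-1); the exponent of
   y_{i,j} in the polarization of mu is 1 if j <= mu_i, and 0 otherwise. *)
Definition polar_mnm (n : nat) (a : 'I_n -> nat) (mu : 'X_{1..n}) :
    'X_{1.. \sum_(i < n) a i} :=
  [multinom nat_of_bool (tagnat.sig2 s < mu (tagnat.sig1 s))%N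
     | s < (\sum_(i < n) a i)%N].

Definition polarization (K : fieldType) (n : nat) (I : {mpoly K[n]} -> Prop) :
    {mpoly K[\sum_(i < n) max_exponent I i]} -> Prop :=
  generated_by (fun nu =>
    exists2 mu, mu \in mingens I & nu = polar_mnm (max_exponent I) mu).
Arguments polarization {K n} I _.

(* The monomial obtained from mu by substituting the variable x_{f i} for
   x_i, for all i. *)
Definition rename (n n' : nat) (f : 'I_n -> 'I_n') (mu : 'X_{1..n}) :
    'X_{1..n'} :=
  [multinom (\sum_(i < n | f i == j) mu i)%N | j < n'].

Definition equivalent (K : fieldType) (n n' : nat)
    (I : {mpoly K[n]} -> Prop) (J : {mpoly K[n']} -> Prop) : Prop :=
  exists2 f : 'I_n -> 'I_n',
    bijective f & [fset rename f mu | mu in mingens I]%fset = mingens J.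

Definition copolar (K : fieldType) (n n' : nat)
    (I : {mpoly K[n]} -> Prop) (J : {mpoly K[n']} -> Prop) : Prop :=
  equivalent (polarization I) (polarization J).

(* [a (existT _ i j)] is a_{i,j} with both indices counted from 0. *)
Definition path_chain (n m : nat) (ms : 'I_n -> nat)
    (a : {i : 'I_n & 'I_(ms i)} -> 'I_m) (i : 'I_n) : {set {set 'I_m}} :=
  [set [set a (existT _ i j') | j' : 'I_(ms i) & (j' <= j)%N]
     | j : 'I_(ms i)].

Definition path_poset (n m : nat) (ms : 'I_n -> nat)
    (a : {i : 'I_n & 'I_(ms i)} -> 'I_m) : {set {set 'I_m}} :=
  \bigcup_(i < n) path_chain a i.

(* Main.v *)
(* A squarefree monomial ideal whose support poset consists of disjoint paths is
   the polarization of an ideal generated by monomials y^b with b_i <= m_i: the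
   generator contains exactly the first b_i vertices of the i-th path.  Hence
   one looks for an antichain G of exponent vectors such that every value
   1 <= j <= m_i is some b_i (so that the vertices of a path are separated) and
   such that for i <> i' some b has b_i = m_i and b_i' = 0 (so that distinct
   paths are separated).
   - If all m_i > 1, G consists of the y_i^{m_i} and of all monomials of degree
     n with b_i < m_i.  The quotient by (G) has a single prime ideal.
   - Otherwise, take all monomials y^b with b_i <= m_i of degree d = max m_i,
     which works if d <= sum_(k <> i) m_k for all i.
   - Otherwise, one m_i is n and the others are 1: take y_i^n, the monomials
     y_i^j y_k with k <> i, where j = 1..n-1 corresponds bijectively to k,
     and the product of the y_k with k <> i. *)
From HB Require Import structures.
Require Import Defs.
From mathcomp Require Import all_boot all_order all_algebra.
From mathcomp Require Import finmap mpoly.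
From mathcomp Require Import perm zify.
From Stdlib Require ClassicalEpsilon FunctionalExtensionality.

Set Implicit Arguments.
Unset Strict Implicit.
Unset Printing Implicit Defensive.

Import GRing.Theory.

(** * Divisibility criterion for monomial ideals; antichains as minimal generating sets *)

Section MonomialGeneration.
Variables (K : fieldType) (n : nat).
Local Open Scope ring_scope.
Implicit Types (p : {mpoly K[n]}) (mu nu : 'X_{1..n}) (S : 'X_{1..n} -> Prop).
Implicit Types (G H : {fset 'X_{1..n}}).

Lemma generated_by_msupp S p :
  generated_by S p <->
  {in msupp p, forall nu, exists2 mu, S mu & (mu <= nu)%MM}.
Proof.
split=> [[s sS ->] nu /msupp_sum_le /flatten_mapP[u]|].
  rewrite mem_filter => /sS Su2; rewrite (perm_mem (msuppMX _ _)).
  by case/mapP=> nu' _ ->; exists u.2; rewrite // lem_addr.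
rewrite {2}[p]mpolyE; elim: (msupp p) => [_|nu r IHr divS].
  by exists [::]; rewrite ?big_nil.
have [nu' r_nu'|s sS s_sum] := IHr.
  by apply: divS; rewrite inE r_nu' orbT.
have [mu Smu le_mu] := divS nu (mem_head _ _).
exists ((p@_nu *: 'X_[nu - mu], mu) :: s) => [u|].
  by rewrite inE => /predU1P[->|/sS].
by rewrite !big_cons s_sum /= -scalerAl -mpolyXD submK.
Qed.

Lemma generated_byX S nu :
  generated_by S ('X_[nu] : {mpoly K[n]}) <-> exists2 mu, S mu & (mu <= nu)%MM.
Proof.
rewrite generated_by_msupp; split=> [|[mu]]; first by apply; rewrite msuppX inE.
by move=> Smu le_mu nu'; rewrite msuppX inE => /eqP ->; exists mu.
Qed.

Definition antichain G :=
  {in G &, forall mu nu, (mu <= nu)%MM -> mu = nu}.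

Lemma generated_by_minimal S G (I : {mpoly K[n]} -> Prop) :
  (forall p, I p <-> generated_by S p) -> (forall mu, mu \in G <-> S mu) ->
  antichain G -> minimal_generators G I.
Proof.
move=> defI GS antiG; have genG: generates G I.
  move=> p; rewrite defI !generated_by_msupp.
  by split=> divG nu /divG[mu Smu le_mu]; exists mu; rewrite // ?GS // -GS.
split=> // H sHG genH; apply/eqP; rewrite eqEfsubset sHG /=.
apply/fsubsetP=> mu Gmu; have: I 'X_[mu].
  by apply/genG/generated_byX; exists mu; rewrite ?lepm_refl.
move/genH/generated_byX=> [nu Hnu /antiG <- //].
exact: (fsubsetP sHG).
Qed.

(** Since [mingens] is chosen by epsilon, uniqueness has to be proved. An element mu of [G] is
    divisible by some nu in the chosen set, and nu by some mu' in [G]; the antichain property gives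
    mu' = mu, hence nu = mu. *)
Lemma mingens_antichain S G (I : {mpoly K[n]} -> Prop) :
  (forall p, I p <-> generated_by S p) -> (forall mu, mu \in G <-> S mu) ->
  antichain G -> mingens I = G.
Proof.
move=> defI GS antiG; have minG := generated_by_minimal defI GS antiG.
have [genH minH] : minimal_generators (mingens I) I.
  have exG : exists G', minimal_generators G' I by exists G.
  exact: ClassicalEpsilon.epsilon_spec (inhabits fset0) _ exG.
move: (mingens I) genH minH => H genH minH.
apply/esym/(minH _ _ minG.1)/fsubsetP=> mu Gmu.
have: I 'X_[mu].
  by apply/minG.1/generated_byX; exists mu; rewrite ?lepm_refl.
move/genH/generated_byX=> [nu Hnu le_nu_mu].
have: I 'X_[nu] by apply/genH/generated_byX; exists nu; rewrite ?lepm_refl.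
move/minG.1/generated_byX=> [mu' Gmu' le_mu'_nu].
have eq_mu: mu' = mu by apply: antiG => //; apply: lepm_trans le_nu_mu.
rewrite eq_mu in le_mu'_nu; suff -> : mu = nu by [].
apply/mnmP=> i; apply/eqP; rewrite eqn_leq.
by rewrite (mnm_lepP le_nu_mu) (mnm_lepP le_mu'_nu).
Qed.

End MonomialGeneration.

(** * Krull dimension zero from pure powers among the generators *)

Section ZeroDimensional.
Variables (K : fieldType) (n : nat) (G : {fset 'X_{1..n}}).
Local Open Scope ring_scope.
Local Open Scope quotient_scope.
Hypothesis G0 : 0%MM \notin G.
Hypothesis G_pure : forall i, exists k, (U_(i) *+ k)%MM \in G.

(** The criterion of [generated_by_msupp] in boolean form, so that it can carry the structure
    [idealr]. *)
Definition in_monomial_ideal (p : {mpoly K[n]}) : bool :=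
  all (fun nu => has (fun mu : 'X_{1..n} => (mu <= nu)%MM) G) (msupp p).

Lemma in_monomial_idealP p :
  reflect (generated_by (fun mu => mu \in G) p) (in_monomial_ideal p).
Proof.
apply: (iffP allP) => [divG|/generated_by_msupp divG nu /divG[mu Gmu le_mu]].
  by apply/generated_by_msupp => nu /divG /hasP.
by apply/hasP; exists mu.
Qed.

Lemma in_monomial_ideal_coef0 p : in_monomial_ideal p -> p@_0 = 0.
Proof.
move/allP=> divG; apply/eqP; rewrite mcoeff_eq0.
apply/negP=> /divG/hasP[mu Gmu].
move/mnm_lepP=> le_mu0; case/negP: G0; suff <- : mu = 0%MM by [].
by apply/mnmP=> i; have:= le_mu0 i; rewrite mnm0E leqn0 => /eqP.
Qed.

Lemma in_monomial_ideal_closed : idealr_closed in_monomial_ideal.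
Proof.
split=> [||c u v Iu Iv]; rewrite ?unfold_in /in_monomial_ideal ?msupp0 //.
- apply/negP=> /in_monomial_ideal_coef0/eqP.
  by rewrite mcoeff1 eqxx oner_eq0.
apply/allP=> nu /msuppD_le; rewrite mem_cat => /orP[/msuppM_le|]; last first.
  exact: allP Iv nu.
case/allpairsP=> -[m1 m2] [/= _ /(allP Iu)/hasP[mu Gmu le_mu] ->].
by apply/hasP; exists mu; rewrite // (lepm_trans le_mu) // lem_addl.
Qed.

HB.instance Definition _ :=
  isIdealr.Build {mpoly K[n]} in_monomial_ideal in_monomial_ideal_closed.

Let A : idealr {mpoly K[n]} := in_monomial_ideal.
Local Notation Q := {ideal_quot A}.

Let coef0Q (x : Q) : K := (repr x)@_0.

(** The constant coefficient does not depend on the representative, because elements of the ideal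
    have none. *)
Let coef0Q_pi p : coef0Q (\pi_Q p) = p@_0.
Proof.
apply/eqP; rewrite -subr_eq0 -mcoeffB; apply/eqP/in_monomial_ideal_coef0.
have: repr (\pi_Q p) == p %[mod Q] by rewrite reprK.
by rewrite -Quotient.idealrBE.
Qed.

(** The constant coefficient is a ring morphism from [Q] to a field, so its kernel is prime. *)
Let coef0Q_prime : idealr_closed (fun x : Q => coef0Q x == 0) /\
  prime_idealr_closed (fun x : Q => coef0Q x == 0).
Proof.
pose pi : {rmorphism {mpoly K[n]} -> Q} := \pi_Q.
have coef0_pi p : coef0Q (pi p) = p@_0 by exact: coef0Q_pi.
have pi_repr x : x = pi (repr x) by rewrite [RHS]reprK.
have coef0D x y : coef0Q (x + y) = coef0Q x + coef0Q y.
  by rewrite (pi_repr x) (pi_repr y) -rmorphD !coef0_pi mcoeffD.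
have coef0M x y : coef0Q (x * y) = coef0Q x * coef0Q y.
  by rewrite (pi_repr x) (pi_repr y) -rmorphM !coef0_pi rmorphM.
split; [split=> [||c u v]|move=> u v]; rewrite ?unfold_in.
- by rewrite -(rmorph0 pi) coef0_pi mcoeff0.
- by rewrite -(rmorph1 pi) coef0_pi mcoeff1 eqxx oner_eq0.
- by rewrite coef0D coef0M => /eqP-> /eqP->; rewrite mulr0 addr0.
by rewrite coef0M mulf_eq0.
Qed.

(* The nilpotent variables lie in every prime of the quotient, so every prime
   contains the maximal ideal of polynomials without constant term. *)
Let coef0Q_sub_prime (P : {pred Q}) :
  idealr_closed P -> prime_idealr_closed P ->
  forall x : Q, coef0Q x = 0 -> x \in P.
Proof.
move=> idP primeP; pose pi : {rmorphism {mpoly K[n]} -> Q} := \pi_Q.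
have [P0 P1 PD] := idP.
have PM c u : u \in P -> c * u \in P by move=> Pu; rewrite -[_ * _]addr0 PD.
have PX i : pi 'X_i \in P.
  have [k Gk] := G_pure i; have: pi ('X_i ^+ k) \in P.
    suff -> : pi ('X_i ^+ k) = 0 by [].
    rewrite -(rmorph0 pi); apply/eqP; rewrite -Quotient.idealrBE subr0.
    apply/in_monomial_idealP; rewrite mpolyXn.
    by apply/generated_byX; exists (U_(i) *+ k)%MM; rewrite ?lepm_refl.
  (* Primality splits off one factor at a time; exponent 0 would put 1 in [P]. *)
  elim: k {Gk} => [|k IHk]; first by rewrite rmorph1 (negPf P1).
  by rewrite exprS rmorphM => /primeP /orP[|/IHk].
move=> x; rewrite /coef0Q => x0; rewrite -[x]reprK -[\pi _]/(pi _).
rewrite [repr x]mpolyE rmorph_sum big_seq.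
apply: (big_ind (fun y => y \in P)) => // [u v Pu Pv|nu nu_x].
  by rewrite -[u]mul1r PD.
have [i nu_i] : exists i, nu i != 0.
  apply/existsP; apply: contraT; rewrite negb_exists => /forallP nu0.
  suff nuE : nu = 0%MM by rewrite mcoeff_msupp nuE x0 eqxx in nu_x.
  by apply/mnmP=> i; have := nu0 i; rewrite negbK mnm0E => /eqP.
rewrite -mul_mpolyC rmorphM PM // -(submK (m := U_(i)) (m' := nu)) ?lep1mP //.
by rewrite mpolyXD rmorphM PM.
Qed.

Lemma zero_dimensional_pure_powers :
  zero_dimensional (generated_by (K := K) (fun mu => mu \in G)).
Proof.
exists A => [p|]; first exact: (rwP (in_monomial_idealP p)).
split; first by exists (fun=> fun x : Q => coef0Q x == 0); split.
case=> P [idP ltP]; have [sub01 [x P1x P0x]] := ltP 0%N isT.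
have [[P0_0 P0_1 _] _] := idP 0%N isT; have [[P1_0 P1_1 P1D] _] := idP 1%N isT.
pose pi : {rmorphism {mpoly K[n]} -> Q} := \pi_Q.
(* The difference c - x has no constant term, so it lies in P_0 and hence in P_1; with x in P_1 this
   puts the unit c in P_1. *)
pose c := coef0Q x; have c0 : c != 0.
  apply: contraNneq P0x => x0; have [? ?] := idP 0%N isT.
  exact: coef0Q_sub_prime.
have: pi c%:MP - x \in P 1%N.
  apply: sub01; have [? ?] := idP 0%N isT; apply: coef0Q_sub_prime => //.
  rewrite -[x]reprK -[\pi _]/(pi _) -rmorphB [LHS]coef0Q_pi mcoeffB mcoeffC.
  by rewrite eqxx mulr1 subrr.
move/(P1D (1 : Q) x _ P1x); rewrite mul1r addrC subrK => P1c.
case/negP: P1_1; have := P1D (pi c^-1%:MP) _ _ P1c P1_0.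
by rewrite addr0 -rmorphM -mpolyCM mulVf // mpolyC1 rmorph1.
Qed.

End ZeroDimensional.

(** * Polarization along an arbitrary numbering of the path vertices *)

Section PolarizationAlong.
Variables (n N : nat) (e : 'I_n -> nat) (b : 'I_N -> {i : 'I_n & 'I_(e i)}).
Implicit Types (mu nu : 'X_{1..n}) (G : {fset 'X_{1..n}}).

(* [polar_mnm e] is the instance [b := tagnat.sig]. *)
Definition polar_along mu : 'X_{1..N} :=
  [multinom nat_of_bool (tagged (b s) < mu (tag (b s)))%N | s < N].

Variables (a : {i : 'I_n & 'I_(e i)} -> 'I_N) (aK : cancel a b).

Lemma polar_along_le mu nu : (forall i, (mu i <= e i)%N) ->
  (polar_along mu <= polar_along nu)%MM -> (mu <= nu)%MM.
Proof.
move=> le_e le_pol; apply/mnm_lepP=> i; case def_k: (mu i) => [//|k].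
have lt_k : (k < e i)%N by rewrite -def_k.
(* Compare at the last vertex of path i that mu reaches; the bound by [e] ensures that this vertex
   exists. *)
have /mnm_lepP/(_ (a (existT _ i (Ordinal lt_k)))) := le_pol.
by rewrite !mnmE aK /= def_k ltnSn; case: ltnP.
Qed.

Lemma antichain_polar_along G :
  {in G, forall mu i, (mu i <= e i)%N} -> antichain G ->
  antichain [fset polar_along mu | mu in G]%fset.
Proof.
move=> le_e antiG _ _ /imfsetP[mu /= Gmu ->] /imfsetP[nu /= Gnu ->] le_pol.
by congr polar_along; apply: antiG (polar_along_le (le_e _ Gmu) le_pol).
Qed.

End PolarizationAlong.

(** * Minimal generators of polarizations, and support classes *)

Section Mingens.
Variables (K : fieldType) (n : nat).

Lemma max_exponent_ge (I : {mpoly K[n]} -> Prop) mu i :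
  mu \in mingens I -> (mu i <= max_exponent I i)%N.
Proof.
move=> Gmu; exact: (leq_bigmax_seq mu Gmu isT).
Qed.

Lemma mingens_generated_by (G : {fset 'X_{1..n}}) :
  antichain G -> mingens (generated_by (K := K) (fun mu => mu \in G)) = G.
Proof. by move=> antiG; apply: (mingens_antichain (fun=> iff_refl _)). Qed.

Lemma support_classP (I : {mpoly K[n]} -> Prop) (s s' : 'I_n) :
  reflect {in mingens I, forall mu : 'X_{1..n}, (0 < mu s)%N -> (0 < mu s')%N}
    (s' \in support_class I s).
Proof.
have -> : (s' \in support_class I s) =
    all (fun mu : 'X_{1..n} => (0 < mu s) ==> (0 < mu s'))%N (mingens I).
  rewrite /support_class; elim: (enum_fset _) => [|mu r /= <-].
    by rewrite big_nil inE.
  by rewrite big_cons; case: ifP; rewrite ?inE.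
apply: (iffP allP) => in_all mu Gmu.
  exact/implyP/in_all.
exact/implyP/in_all.
Qed.

Lemma mingens_polarization (J : {mpoly K[n]} -> Prop) :
  antichain (mingens J) ->
  mingens (polarization J) =
    [fset polar_mnm (max_exponent J) mu | mu in mingens J]%fset.
Proof.
move=> antiJ; apply: (mingens_antichain (fun=> iff_refl _)) => [mu|].
  split=> [/imfsetP[nu /= Gnu ->]|[nu Gnu ->]]; first by exists nu.
  exact: in_imfset.
apply: (@antichain_polar_along _ _ _ tagnat.sig tagnat.rank tagnat.rankK) => //.
by move=> mu Gmu i; apply: max_exponent_ge.
Qed.

End Mingens.

Lemma rename_can (n n' : nat) (f : 'I_n -> 'I_n') (g : 'I_n' -> 'I_n)
    (mu : 'X_{1..n}) :
  cancel f g -> cancel g f -> rename f mu = [multinom mu (g j) | j < n'].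
Proof.
move=> fK gK; apply/mnmP=> j; rewrite !mnmE (big_pred1 (g j)) // => i.
by rewrite (can2_eq fK gK).
Qed.

(** A squarefree monomial is polarized by merely relabelling x_s as x_{s,1}; [f] sends x_{s,1} to
    the variable y_{i,j} of the vertex [b s]. *)
Lemma rename_polar_along (n m : nat) (ms : 'I_n -> nat) (e : 'I_m -> nat)
    (a : {i : 'I_n & 'I_(ms i)} -> 'I_m) (b : 'I_m -> {i : 'I_n & 'I_(ms i)}) :
  cancel a b -> cancel b a -> e =1 (fun=> 1) ->
  exists2 f : 'I_(\sum_(i < m) e i) -> 'I_(\sum_(i < n) ms i), bijective f &
    forall mu, rename f (polar_mnm e (polar_along b mu)) = polar_mnm ms mu.
Proof.
(* [e] occurs in the types of the monomials, so it is replaced as a whole function. *)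
move=> aK bK /FunctionalExtensionality.functional_extensionality ->.
pose f (s : 'I_(\sum_(i < m) 1)) := tagnat.rank (b (tagnat.sig1 s)).
pose g s := @tagnat.Rank m (fun=> 1) (a (tagnat.sig s)) ord0.
have fK : cancel f g.
  move=> s; rewrite /g /f tagnat.rankK bK -[RHS]tagnat.sig2K.
  by congr tagnat.Rank; rewrite (ord1 (tagnat.sig2 s)).
have gK : cancel g f by move=> s; rewrite /f tagnat.Rank1K aK tagnat.sigK.
exists f => [|mu]; first by exists g.
rewrite (rename_can _ fK gK); apply/mnmP=> s.
rewrite !mnmE /tagnat.sig2 /g /tagnat.Rank /tagnat.sig1 tagnat.rankK /= aK.
by rewrite lt0b.
Qed.

(** * From an antichain of exponent vectors to the ideals I and J *)

Section FromAntichain.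

Variables (K : fieldType) (n m : nat) (ms : 'I_n -> nat).
Variables (a : {i : 'I_n & 'I_(ms i)} -> 'I_m).
Variables (b : 'I_m -> {i : 'I_n & 'I_(ms i)}).
Hypotheses (aK : cancel a b) (bK : cancel b a).
Hypothesis ms_gt0 : forall i, (0 < ms i)%N.
Variable G : {fset 'X_{1..n}}.
Hypothesis antiG : antichain G.
Hypothesis G_le : {in G, forall (mu : 'X_{1..n}) i, (mu i <= ms i)%N}.
Hypothesis G_val :
  forall i j, (0 < j <= ms i)%N -> exists2 mu, mu \in G & mu i = j.
Hypothesis G_sep : forall i i', i != i' ->
  exists2 mu, mu \in G & mu i = ms i /\ mu i' = 0%N.

Let J := generated_by (K := K) (fun mu => mu \in G).
Let GI := [fset polar_along b mu | mu in G]%fset.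
Let I := generated_by (K := K) (fun mu => mu \in GI).

Let antiGI : antichain GI.
Proof. exact: antichain_polar_along aK _ G_le antiG. Qed.

Let mingensJ : mingens J = G. Proof. exact: mingens_generated_by. Qed.
Let mingensI : mingens I = GI. Proof. exact: mingens_generated_by. Qed.

Let GI_squarefree mu : mu \in GI -> squarefree mu.
Proof. by case/imfsetP=> nu _ -> s; rewrite mnmE; case: ltnP. Qed.

Let full_support_I : full_support I.
Proof.
move=> s; pose i := tag (b s); pose j : 'I_(ms i) := tagged (b s).
have [mu Gmu mu_s] := @G_val i j.+1 (ltn_ord _).
exists (polar_along b mu); last by rewrite mnmE mu_s ltnSn.
by rewrite mingensI in_imfset.
Qed.

(** A generator contains vertex j of path i exactly when j < mu_i. Hence the generators cut out
    initial segments, [G_sep] excludes vertices of other paths, and a mu with mu_i = j+1 excludes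
    the later vertices of path i. *)
Let support_class_I i (j : 'I_(ms i)) :
  support_class I (a (existT _ i j)) =
  [set a (existT _ i j') | j' : 'I_(ms i) & (j' <= j)%N].
Proof.
apply/setP=> s; rewrite -[s]bK; case: (b s) => i' j' {s}.
apply/support_classP/imsetP => [|[j2]].
  rewrite mingensI => in_all.
  have {}in_all mu : mu \in G -> (j < mu i)%N -> (j' < mu i')%N.
    move=> Gmu j_mu; have := in_all (polar_along b mu).
    by rewrite in_imfset // !mnmE !aK /= j_mu !lt0b; apply.
  have eq_i : i = i'.
    apply/eqP; apply: contraT => /G_sep[mu Gmu [mu_i mu_i']].
    by have := in_all mu Gmu; rewrite mu_i mu_i' => /(_ (ltn_ord j)).
  case: _ / eq_i j' in_all => j' in_all; exists j' => //; rewrite inE.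
  have [mu Gmu mu_i] := @G_val i j.+1 (ltn_ord _).
  by have := in_all mu Gmu; rewrite mu_i ltnS => /(_ (leqnn _)).
rewrite inE => le_j /(can_inj aK) ->; rewrite mingensI.
by move=> _ /imfsetP[mu _ ->]; rewrite !mnmE !aK !lt0b; apply: leq_ltn_trans.
Qed.

Let support_poset_I : support_poset I = path_poset a.
Proof.
apply/setP=> C; apply/imsetP/bigcupP => [[s _ ->]|[i _ /imsetP[j _ ->]]].
  rewrite -[s]bK; case: (b s) => i j; exists i => //.
  by rewrite support_class_I; apply/imsetP; exists j.
by exists (a (existT _ i j)); rewrite ?support_class_I.
Qed.

Let full_support_J : full_support J.
Proof.
move=> i; have [|mu Gmu mu_i] := @G_val i 1; first by rewrite ms_gt0.
by exists mu; rewrite ?mingensJ ?mu_i.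
Qed.

Let max_exponent_J : max_exponent J = ms.
Proof.
apply: FunctionalExtensionality.functional_extensionality => i.
rewrite /max_exponent mingensJ; apply/eqP; rewrite eqn_leq; apply/andP; split.
  by apply/bigmax_leqP_seq => mu /G_le.
have [|mu Gmu <-] := @G_val i (ms i); first by rewrite ms_gt0 leqnn.
exact: leq_bigmax_seq.
Qed.

Let max_exponent_I s : max_exponent I s = 1%N.
Proof.
apply/eqP; rewrite eqn_leq; apply/andP; split.
  by apply/bigmax_leqP_seq => mu; rewrite mingensI => /GI_squarefree.
have [mu Gmu mu_s] := full_support_I s.
exact: leq_trans mu_s (max_exponent_ge _ Gmu).
Qed.

Let copolar_IJ : copolar I J.
Proof.
rewrite /copolar /equivalent.
rewrite !mingens_polarization ?mingensI ?mingensJ // max_exponent_J.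
have [f bij_f fE] := rename_polar_along aK bK max_exponent_I.
exists f => //; apply/fsetP=> nu.
apply/imfsetP/imfsetP => /= [[_ /imfsetP[_ /= /imfsetP[mu /= Gmu ->] ->] ->]|].
  by exists mu.
case=> mu Gmu ->; rewrite -fE.
exists (polar_mnm (max_exponent I) (polar_along b mu)) => //.
by rewrite !in_imfset.
Qed.

Lemma path_poset_of_antichain :
  ((forall i, (1 < ms i)%N) -> forall i, (U_(i) *+ ms i)%MM \in G) ->
  (0 < n)%N ->
  exists I : {mpoly K[m]} -> Prop,
    [/\ squarefree_monomial_ideal I, full_support I,
        support_poset I = path_poset a
      & (forall i : 'I_n, (1 < ms i)%N) ->
        exists (k : nat) (J : {mpoly K[k]} -> Prop),
          [/\ monomial_ideal J, full_support J, zero_dimensional J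
            & copolar I J]].
Proof.
move=> G_pure n_gt0; pose i0 := Ordinal n_gt0; exists I; split=> //.
  by exists (fun mu => mu \in GI).
move=> ms_gt1; exists n, J; split=> //; first by exists (fun mu => mu \in G).
apply: zero_dimensional_pure_powers => [|i]; last first.
  by exists (ms i); apply: G_pure.
(* If 1 were in [G], it would divide this nontrivial mu, against the antichain property. *)
have [|mu Gmu mu_i] := @G_val i0 1; first by rewrite ms_gt0.
apply/negP=> G0; suff mu0: 0%MM = mu by rewrite -mu0 mnm0E in mu_i.
by apply: antiG => //; apply/mnm_lepP=> i; rewrite mnm0E.
Qed.

End FromAntichain.

(** * Bounded exponent vectors of prescribed degree *)

Section ExponentVectors.
Variable n : nat.
Implicit Types (mu nu : 'X_{1..n}) (c : 'I_n -> nat).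

Lemma lepm_mdeg_eq mu nu : (mu <= nu)%MM -> mdeg mu = mdeg nu -> mu = nu.
Proof.
move=> /submK le_mu; rewrite -[in mdeg nu]le_mu mdegD => /eqP.
rewrite -{1}[mdeg mu]add0n eqn_add2r eq_sym mdeg_eq0 => /eqP mu0.
by rewrite -le_mu mu0 add0m.
Qed.

(** Greedy: as long as the degree is below the sum of the caps, some exponent can be raised by
    one. *)
Lemma exists_mnm_mdeg c d : d <= \sum_i c i ->
  exists2 mu : 'X_{1..n}, forall i, mu i <= c i & mdeg mu = d.
Proof.
elim: d => [_|d IHd lt_d].
  by exists 0%MM; rewrite ?mdeg0 // => i; rewrite mnm0E.
have [mu le_mu deg_mu] := IHd (ltnW lt_d).
have [i lt_i] : exists i, mu i < c i.
  apply/existsP; apply: contraLR lt_d.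
  rewrite negb_exists -leqNgt -deg_mu mdegE.
  by move=> /forallP ge_mu; apply: leq_sum => i _; rewrite leqNgt.
exists (mu + U_(i))%MM => [k|]; last by rewrite mdegD mdeg1 deg_mu addn1.
by rewrite mnmDE mnm1E; case: eqP => [<-|_]; rewrite ?addn1 ?addn0.
Qed.

(** Distribute degree d - j with cap 0 at i, then multiply by y_i^j. *)
Lemma exists_mnm_mdeg_at c d i j : j <= d <= j + \sum_(k | k != i) c k ->
  exists mu : 'X_{1..n},
    [/\ mu i = j, forall k, k != i -> mu k <= c k & mdeg mu = d].
Proof.
case/andP=> le_jd le_d; pose c0 k := if k == i then 0 else c k.
have [|mu le_mu deg_mu] := @exists_mnm_mdeg c0 (d - j).
  rewrite leq_subLR (leq_trans le_d) // leq_add2l.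
  rewrite [leqRHS](bigD1 i) //= /c0 eqxx add0n.
  by apply: leq_sum => k /negPf ->.
exists (mu + U_(i) *+ j)%MM; split=> [|k ne_k|].
- have := le_mu i; rewrite /c0 eqxx mnmDE mulmnE mnm1E eqxx mul1n leqn0.
  by move/eqP->.
- have := le_mu k; rewrite /c0 (negPf ne_k) mnmDE mulmnE mnm1E eq_sym.
  by rewrite (negPf ne_k) addn0.
by rewrite mdegD deg_mu mdegMn mdeg1 mul1n subnK.
Qed.

(** Passing through the finite type of monomials of degree at most d makes this a finite set. *)
Definition homog_mnms d c : {fset 'X_{1..n}} :=
  [fset val mu | mu : 'X_{1..n < d.+1}
     & (mdeg (val mu) == d) && [forall i, val mu i <= c i]]%fset.

Lemma homog_mnmsP d c mu :
  reflect (mdeg mu = d /\ forall i, mu i <= c i) (mu \in homog_mnms d c).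
Proof.
apply: (iffP idP) => [/imfsetP[nu /=]|[deg_mu le_mu]].
  by rewrite inE => /andP[/eqP deg_nu /forallP le_nu] ->.
have lt_d : mdeg mu < d.+1 by rewrite deg_mu.
apply/imfsetP; exists (BMultinom lt_d); rewrite //= inE /= deg_mu eqxx.
exact/forallP.
Qed.

Lemma antichain_homog_mnms d c : antichain (homog_mnms d c).
Proof.
move=> mu nu /homog_mnmsP[deg_mu _] /homog_mnmsP[deg_nu _] /lepm_mdeg_eq.
by apply; rewrite deg_nu.
Qed.

(* The last two conditions say that the polarizations of the elements of [G]
   have the disjoint paths of lengths [ms i] as support poset. *)
Definition path_antichain (ms : 'I_n -> nat) (G : {fset 'X_{1..n}}) : Prop :=
  [/\ antichain G, {in G, forall (mu : 'X_{1..n}) i, mu i <= ms i},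
      forall i j, 0 < j <= ms i -> exists2 mu, mu \in G & mu i = j
    & forall i i', i != i' ->
        exists2 mu, mu \in G & mu i = ms i /\ mu i' = 0].

(** * The three constructions of the antichain *)

Variable ms : 'I_n -> nat.
Hypothesis ms_le : forall i, 0 < ms i <= n.
Hypothesis n_gt1 : 1 < n.

Let sum_ge_card c i : (forall k, 0 < c k) -> n.-1 <= \sum_(k | k != i) c k.
Proof.
move=> c_gt0; have <- : \sum_(k | k != i) 1 = n.-1.
  by rewrite sum1_card cardC1 card_ord.
exact: leq_sum.
Qed.

Lemma path_antichain_pure : (forall i, 1 < ms i) ->
  path_antichain ms ([fset U_(i) *+ ms i | i : 'I_n]
    `|` homog_mnms n (fun i => (ms i).-1))%MM%fset.
Proof.
move=> ms_gt1; set G := (_ `|` _)%fset.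
have pureE i k : (U_(i) *+ ms i)%MM k = if i == k then ms i else 0.
  by rewrite mulmnE mnm1E; case: eqP => _; rewrite ?mul1n.
have G_pure i : (U_(i) *+ ms i)%MM \in G.
  by rewrite in_fsetU; apply/orP; left; apply/imfsetP; exists i.
have GP mu : mu \in G -> (exists i, mu = U_(i) *+ ms i)%MM \/
    mdeg mu = n /\ forall i, mu i < ms i.
  rewrite in_fsetU => /orP[/imfsetP[i _ ->]|/homog_mnmsP[deg_mu lt_mu]].
    by left; exists i.
  by right; split=> // i; have := lt_mu i; have := ms_gt1 i; lia.
split=> [mu nu /GP[[i ->]|[deg_mu lt_mu]] /GP[[k ->]|[deg_nu lt_nu]]|mu /GP||].
- move/mnm_lepP/(_ i); rewrite !pureE eqxx; case: eqP => [->//|_].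
  by have := ms_gt1 i; lia.
- by move/mnm_lepP/(_ i); rewrite pureE eqxx leqNgt lt_nu.
(* A divisor of a power of y_k is a power of y_k, but degree n with mu_k < m_k <= n is
   impossible. *)
- move/mnm_lepP=> le_mu; have: mdeg mu = mu k.
    rewrite mdegE (bigD1 k) //= big1 ?addn0 // => i ne_ik.
    by have := le_mu i; rewrite pureE eq_sym (negPf ne_ik); lia.
  by have := lt_mu k; have := ms_le k; lia.
- by move/lepm_mdeg_eq; apply; rewrite deg_nu.
- case=> [[i ->] k|[_ lt_mu] k]; last exact: ltnW.
  by rewrite pureE; case: eqP => [->|].
- move=> i j; rewrite [_ <= ms i]leq_eqVlt => /andP[j_gt0 /predU1P[->|lt_j]].
    by exists (U_(i) *+ ms i)%MM; rewrite ?pureE ?eqxx.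
  have [|mu [mu_i le_mu deg_mu]] :=
      @exists_mnm_mdeg_at (fun k => (ms k).-1) n i j.
    (* The n-1 other variables have caps m_k - 1 >= 1, leaving room for the remaining degree n - j
       <= n-1. *)
    have pred_gt0 k : 0 < (ms k).-1 by have := ms_gt1 k; lia.
    by have := sum_ge_card i pred_gt0; have := ms_le i; lia.
  exists mu => //; rewrite in_fsetU; apply/orP; right; apply/homog_mnmsP.
  split=> // k; case: (eqVneq k i) => [->|]; last exact: le_mu.
  by rewrite mu_i; lia.
move=> i i' ne_i; exists (U_(i) *+ ms i)%MM => //.
by rewrite !pureE eqxx (negPf ne_i).
Qed.

Lemma path_antichain_homog d : (forall i, ms i <= d) ->
  (forall i, d <= \sum_(k | k != i) ms k) ->
  path_antichain ms (homog_mnms d ms).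
Proof.
move=> ms_le_d d_le; split=> [|mu /homog_mnmsP[]//|i j le_j|i i' ne_i].
- exact: antichain_homog_mnms.
- have [|mu [mu_i le_mu deg_mu]] := @exists_mnm_mdeg_at ms d i j.
    by have := ms_le_d i; have := d_le i; lia.
  exists mu => //; apply/homog_mnmsP; split=> // k.
  by case: (eqVneq k i) => [->|]; [rewrite mu_i; lia|exact: le_mu].
(* Forbidding y_i' leaves total capacity sum_(k <> i') m_k, which is at least d by assumption, even
   with y_i used up to m_i. *)
pose c k := if k == i' then 0 else ms k.
have [|mu [mu_i le_mu deg_mu]] := @exists_mnm_mdeg_at c d i (ms i).
  rewrite ms_le_d (leq_trans (d_le i')) // (bigD1 i) //= leq_add2l.
  rewrite [leqRHS](bigD1 i') /=; last by rewrite eq_sym.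
  rewrite /c eqxx add0n; under [leqRHS]eq_bigr => k /andP[_ /negPf->] do over.
  by under [leqRHS]eq_bigl => k do rewrite andbC.
have mu_i' : mu i' = 0 by have := le_mu i'; rewrite /c eqxx eq_sym ne_i; lia.
exists mu => //; apply/homog_mnmsP; split=> // k.
case: (eqVneq k i) => [->|/le_mu]; first by rewrite mu_i.
by rewrite /c; case: eqP => [->|//]; rewrite mu_i'.
Qed.

Lemma path_antichain_star i0 : 2 < n -> ms i0 = n ->
  (forall k, k != i0 -> ms k = 1) -> exists G, path_antichain ms G.
Proof.
move=> n_gt2 ms_i0 ms_1; pose z := Ordinal (ltnW n_gt1).
(* Swapping [i0] with index 0 maps the k <> i0 bijectively onto the indices 1..n-1, which serve as
   exponents of y_i0. *)
pose t (k : 'I_n) : 'I_n := tperm i0 z k.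
pose star k := (U_(i0) *+ t k + U_(k))%MM.
pose top := (U_(i0) *+ n)%MM.
pose rest : 'X_{1..n} := [multinom nat_of_bool (k != i0) | k < n].
have t_gt0 k : k != i0 -> 0 < t k.
  move=> ne_k; rewrite lt0n; apply: contraNneq ne_k => t0.
  have tz : t k = z by apply: val_inj.
  by rewrite -(tpermK i0 z k) -/(t k) tz tpermR.
have starE k i : k != i0 -> star k i = if i == i0 then t k : nat else (i == k).
  move=> ne_k; rewrite mnmDE mulmnE !mnm1E ![_ == i]eq_sym.
  case: (eqVneq i i0) => [->|_]; rewrite ?mul1n ?mul0n //.
  by rewrite eq_sym (negPf ne_k) addn0.
have topE i : top i = if i == i0 then n else 0.
  by rewrite mulmnE mnm1E eq_sym; case: eqP; rewrite ?mul1n.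
have restE i : rest i = (i != i0) by rewrite mnmE.
(* This is where n > 2 enters: a third variable keeps [rest] from dividing a [star k]. *)
have other k k' : exists2 i, i != k & i != k' :> 'I_n.
  have: 0 < #|[set~ k] :\ k'|.
    have := cardsD1 k' [set~ k]; rewrite cardsC1 card_ord.
    by case: (k' \in _); lia.
  by case/card_gt0P=> i; rewrite !inE => /andP[]; exists i.
exists ([fset top; rest] `|` [fset star k | k in [pred k | k != i0]])%fset.
set G := (_ `|` _)%fset.
have Gtop : top \in G by rewrite in_fsetU in_fset2 eqxx.
have Grest : rest \in G by rewrite in_fsetU in_fset2 eqxx orbT.
have Gstar k : k != i0 -> star k \in G.
  by move=> ne_k; rewrite in_fsetU; apply/orP; right; apply/imfsetP; exists k.
have GP mu : mu \in G ->
    [\/ mu = top, mu = rest | exists2 k, k != i0 & mu = star k].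
  rewrite in_fsetU in_fset2 => /orP[/orP[]/eqP->|/imfsetP[k /= ne_k ->]].
  - by constructor 1.
  - by constructor 2.
  by constructor 3; exists k.
split=> [mu nu|mu /GP|i j|i i'].
- case/GP=> [->|->|[k ne_k ->]] /GP[->|->|[k' ne_k' ->]] //.
  + by move/mnm_lepP/(_ i0); rewrite topE restE eqxx; lia.
  + by move/mnm_lepP/(_ i0); rewrite topE starE // eqxx leqNgt ltn_ord.
  + have [i ne_i _] := other i0 i0.
    by move/mnm_lepP/(_ i); rewrite topE restE (negPf ne_i).
  + have [i ne_i ne_ik] := other i0 k'.
    by move/mnm_lepP/(_ i); rewrite restE starE // (negPf ne_i) (negPf ne_ik).
  + by move/mnm_lepP/(_ k); rewrite topE starE // (negPf ne_k) eqxx.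
  + move/mnm_lepP/(_ i0); rewrite restE starE // eqxx.
    by have := t_gt0 k ne_k; lia.
  move/mnm_lepP/(_ k); rewrite !starE // (negPf ne_k) eqxx.
  by case: eqP => [->|].
- case=> [->|->|[k ne_k ->]] i; rewrite ?topE ?restE ?starE //.
  + by case: eqP => [->|]; rewrite ?ms_i0.
  + by case: eqP => // /eqP/ms_1 ->.
  case: eqP => [->|/eqP/ms_1 ->]; last by case: eqP.
  by rewrite ms_i0 ltnW // ltn_ord.
- case: (eqVneq i i0) => [->|ne_i]; last first.
    rewrite ms_1 // => /anti_leq <-; exists (star i); first exact: Gstar.
    by rewrite starE // (negPf ne_i) eqxx.
  rewrite ms_i0 [_ <= n]leq_eqVlt => /andP[j_gt0 /predU1P[->|lt_j]].
    by exists top; rewrite ?topE ?eqxx.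
  (* As [t] is an involution, [star (t j)] has exponent j at [i0]; j > 0 makes its index differ from
     [i0]. *)
  have ne_k : t (Ordinal lt_j) != i0.
    apply/eqP=> /(congr1 (tperm i0 z)); rewrite tpermK tpermL => /(congr1 val).
    by move=> /=; lia.
  exists (star (t (Ordinal lt_j))); first exact: Gstar.
  by rewrite starE // eqxx /t tpermK.
case: (eqVneq i i0) => [->|ne_i] ne_i'.
  by exists top; rewrite ?topE ?eqxx ?ms_i0 // eq_sym (negPf ne_i').
case: (eqVneq i' i0) => [->|ne_i'0].
  by exists rest; rewrite // !restE eqxx ne_i ms_1.
exists (star i); first exact: Gstar.
by rewrite !starE // (negPf ne_i) (negPf ne_i'0) eqxx eq_sym (negPf ne_i') ms_1.
Qed.

Lemma exists_path_antichain :
  2 < n \/ (n = 2 /\ forall i j, ms i = ms j) ->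
  exists2 G, path_antichain ms G &
    (forall i, 1 < ms i) -> forall i, (U_(i) *+ ms i)%MM \in G.
Proof.
move=> n_cond; have [ms_gt1|/forallPn[i1 ms_i1]] := boolP [forall i, 1 < ms i].
  exists ([fset U_(i) *+ ms i | i : 'I_n]
    `|` homog_mnms n (fun i => (ms i).-1))%MM%fset.
    exact/path_antichain_pure/forallP.
  by move=> _ i; rewrite in_fsetU; apply/orP; left; apply/imfsetP; exists i.
(* A path of length 1 makes the pure power condition vacuous. *)
suff [G antiG] : exists G, path_antichain ms G.
  by exists G => // /(_ i1); rewrite (negPf ms_i1).
pose d := \max_i ms i; have ms_le_d i : ms i <= d by apply: leq_bigmax.
have [/forallP d_le|/forallPn[i0]] :=
  boolP [forall i : 'I_n, d <= \sum_(k | k != i) ms k].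
  by exists (homog_mnms d ms); apply: path_antichain_homog.
rewrite -ltnNge => gt_d; have ms_gt0 k : 0 < ms k by case/andP: (ms_le k).
have d_le : d <= n by apply/bigmax_leqP => k _; case/andP: (ms_le k).
have sum_ge := sum_ge_card i0 ms_gt0.
(* From n-1 <= sum_(k <> i0) m_k < d <= n, the sum is n-1 and d = n, so its n-1 positive terms are
   all 1 and the maximum n is reached at [i0]. *)
have ms_1 k : k != i0 -> ms k = 1.
  move=> ne_k; move: gt_d; rewrite (bigD1 k) //=.
  have card_ne : \sum_(i < n | i != i0) 1 = n.-1.
    by rewrite sum1_card cardC1 card_ord.
  rewrite (bigD1 k) //= in card_ne; move: card_ne.
  have: \sum_(i < n | (i != i0) && (i != k)) 1 <=
        \sum_(i < n | (i != i0) && (i != k)) ms i by apply: leq_sum.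
  set s1 := \sum_(i < n | _) 1; set s := \sum_(i < n | _) _.
  by have := ms_gt0 k; lia.
have ms_i0 : ms i0 = n.
  have [|k] := @eq_bigmax _ ms; first by rewrite card_ord; lia.
  rewrite -/d; case: (eqVneq k i0) => [->|/ms_1->]; lia.
case: n_cond => [n_gt2|[n2 ms_eq]]; first exact: path_antichain_star ms_i0 ms_1.
(* For n = 2 the lengths would be 2 at [i0] and 1 at [i1], against their equality. *)
by have := ms_eq i0 i1; have := ms_gt0 i1; lia.
Qed.

End ExponentVectors.

Theorem proposition3p13 (K : fieldType) (n m : nat) (ms : 'I_n -> nat)
    (a : {i : 'I_n & 'I_(ms i)} -> 'I_m) :
  0 < n ->
  (forall i : 'I_n, 1 <= ms i <= n) ->
  m = \sum_(i < n) ms i ->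
  injective a ->
  2 < n \/ (n = 2 /\ forall i j : 'I_n, ms i = ms j) ->
  exists I : {mpoly K[m]} -> Prop,
    [/\ squarefree_monomial_ideal I, full_support I,
        support_poset I = path_poset a
      & (forall i : 'I_n, 1 < ms i) ->
        exists (k : nat) (J : {mpoly K[k]} -> Prop),
          [/\ monomial_ideal J, full_support J, zero_dimensional J
            & copolar I J]].
Proof.
move=> n_gt0 ms_le def_m inj_a n_cond.
(* There are m vertices in total, so the injection [a] is a bijection. *)
have [|b aK bK] := inj_card_bij inj_a.
  by rewrite card_ord tagnat.card def_m.
have n_gt1 : 1 < n by case: n_cond => [|[]]; lia.
have [G [antiG G_le G_val G_sep] G_pure] :=
  exists_path_antichain ms_le n_gt1 n_cond.
have ms_gt0 i : 0 < ms i by case/andP: (ms_le i).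
exact: (path_poset_of_antichain K aK bK ms_gt0 antiG G_le G_val G_sep).
Qed.
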